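(* Let $A:\mathbb{R}^d\to\mathcal{G}$ be a bounded linear operator into a real Hilbert space $\mathcal{G}$, let $g\in\mathcal{G}$, $\mu>0$, and suppose $0<\tau<2/\|A\|^2$. Let $f_0\in\mathbb{R}^d$ be such that $\sigma_0=\|Af_0-g\|>0$, and let $\{(f_k,\sigma_k)\}_{k\ge 0}$ be defined by $$f_{k+1}=S_{2\tau\mu\sigma_k}\big(f_k+\tau A^*(g-Af_k)\big),\qquad \sigma_{k+1}=\|Af_{k+1}-g\|,\qquad k=0,1,\dots.$$ Then the sequence $\{(f_k,\sigma_k)\}_k$ converges. If moreover $\lim_k\sigma_k>0$, then $\lim_k f_k$ is a minimizer of $\Phi_\mu(f)=\|Af-g\|+\mu\|f\|_1$ over $\mathbb{R}^d$.
   Context: $\mathbb{R}^d$ carries its Euclidean norm $\|\cdot\|$ and a fixed orthonormal basis $\{\varphi_\gamma\}_{\gamma\in\Gamma}$; for $f\in\mathbb{R}^d$, $f_\gamma=(f,\varphi_\gamma)$ and $\|f\|_1=\sum_{\gamma}|f_\gamma|$. $\|A\|$ is the operator (spectral) norm and $A^*$ the adjoint of $A$. For $t\ge 0$ the soft-thresholding function on $\mathbb{R}$ is $S_t(x)=x+t/2$ if $x\le -t/2$, $S_t(x)=0$ if $|x|<t/2$, $S_t(x)=x-t/2$ if $x\ge t/2$; it acts on vectors component-wise: $S_t(h)=\sum_\gamma S_t(h_\gamma)\varphi_\gamma$ where $h=\sum_\gamma h_\gamma\varphi_\gamma$. *)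

(* Defs.v *)
From HB Require Import structures.
From mathcomp Require Import all_boot all_order all_algebra.
From mathcomp Require Import all_classical all_reals all_analysis.

Set Implicit Arguments.
Unset Strict Implicit.
Unset Printing Implicit Defensive.

Import Order.TTheory GRing.Theory Num.Theory.
Import numFieldNormedType.Exports.

#[global] Open Scope classical_set_scope.
#[global] Open Scope ring_scope.

(* R^d is 'rV[R]_d. The norm that the library puts on matrices is the sup norm,
   so the Euclidean inner product and norm are defined here; both norms induce
   the library's topology on 'rV[R]_d, in which limits are taken. *)
Definition dotv (R : realType) (d : nat) (u v : 'rV[R]_d) : R :=
  \sum_(i < d) u 0 i * v 0 i.

Definition enorm (R : realType) (d : nat) (u : 'rV[R]_d) : R :=
  Num.sqrt (dotv u u).

Definition orthonormal_basis (R : realType) (d : nat) (Gam : finType)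
    (phi : Gam -> 'rV[R]_d) : Prop :=
  basis_of fullv (codom phi) /\
  forall a b : Gam, dotv (phi a) (phi b) = (a == b)%:R.

(* A real Hilbert space is a complete normed module G together with a dot
   product ip on it that induces the norm of G. *)
Definition induces_norm (R : realType) (G : completeNormedModType R)
    (ip : {dot G for idfun}) : Prop :=
  forall x : G, `|x| = Num.sqrt (ip x x).

Definition bounded_operator (R : realType) (d : nat)
    (G : completeNormedModType R) (A : 'rV[R]_d -> G) : Prop :=
  exists M : R, forall f : 'rV[R]_d, `|A f| <= M * enorm f.

Definition opnorm (R : realType) (d : nat) (G : completeNormedModType R)
    (A : 'rV[R]_d -> G) : R :=
  sup [set `|A f| | f in [set f : 'rV[R]_d | enorm f <= 1]].

Definition is_adjoint (R : realType) (d : nat) (G : completeNormedModType R)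
    (ip : {dot G for idfun}) (A : 'rV[R]_d -> G) (B : G -> 'rV[R]_d) : Prop :=
  forall (f : 'rV[R]_d) (y : G), ip (A f) y = dotv f (B y).

(* The adjoint, chosen by its defining property; see adjointP and
   is_adjoint_unique below. *)
Definition adjoint (R : realType) (d : nat) (G : completeNormedModType R)
    (ip : {dot G for idfun}) (A : 'rV[R]_d -> G) : G -> 'rV[R]_d :=
  xget (fun=> 0) [set B | is_adjoint ip A B].

Lemma adjointP (R : realType) (d : nat) (G : completeNormedModType R)
    (ip : {dot G for idfun}) (A : {linear 'rV[R]_d -> G}) :
  is_adjoint ip A (adjoint ip A).
Proof.
have ex : is_adjoint ip A (fun y => \row_i ip (A (delta_mx 0 i)) y).
  move=> f y; rewrite {1}(row_sum_delta f) linear_sum linear_sumlz /dotv.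
  by apply: eq_bigr => i _; rewrite linearZ linearZl_LR mxE.
rewrite /adjoint.
by have := xgetPex (fun=> 0 : 'rV[R]_d) (ex_intro [set B | is_adjoint ip A B] _ ex).
Qed.

Lemma is_adjoint_unique (R : realType) (d : nat) (G : completeNormedModType R)
    (ip : {dot G for idfun}) (A : 'rV[R]_d -> G) (B C : G -> 'rV[R]_d) :
  is_adjoint ip A B -> is_adjoint ip A C -> B = C.
Proof.
have dotE (u : 'rV[R]_d) j : dotv (delta_mx 0 j) u = u 0 j.
  rewrite /dotv (bigD1 j) //= big1 ?addr0 => [|i /negbTE ne_ij].
    by rewrite mxE !eqxx mul1r.
  by rewrite mxE ne_ij andbF mul0r.
move=> hB hC; apply/funext => y; apply/rowP => j.
by rewrite -!dotE -hB -hC.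
Qed.

Definition soft (R : realType) (t x : R) : R :=
  if x <= - (t / 2) then x + t / 2
  else if `|x| < t / 2 then 0
  else x - t / 2.

Definition softv (R : realType) (d : nat) (Gam : finType)
    (phi : Gam -> 'rV[R]_d) (t : R) (h : 'rV[R]_d) : 'rV[R]_d :=
  \sum_(a : Gam) soft t (dotv h (phi a)) *: phi a.

Definition norm1 (R : realType) (d : nat) (Gam : finType)
    (phi : Gam -> 'rV[R]_d) (f : 'rV[R]_d) : R :=
  \sum_(a : Gam) `|dotv f (phi a)|.

Definition Phi (R : realType) (d : nat) (Gam : finType)
    (phi : Gam -> 'rV[R]_d) (G : completeNormedModType R)
    (A : 'rV[R]_d -> G) (g : G) (mu : R) (f : 'rV[R]_d) : R :=
  `|A f - g| + mu * norm1 phi f.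

Definition minimizer (R : realType) (T : Type) (F : T -> R) (x : T) : Prop :=
  forall y : T, F x <= F y.

(* Main.v *)
(* Where sigma_k > 0, A^*(A f_k - g) / sigma_k is the gradient of |A f - g| at
   f_k, so f_{k+1} is a proximal gradient step for Phi_mu with step size
   tau sigma_k.  Writing h_k = f_{k+1} - f_k, this gives for every u
     |f_{k+1} - u|^2 + 2 tau sigma_k (Phi f_{k+1} - Phi u)
        <= |f_k - u|^2 + tau |A h_k|^2 - |h_k|^2.
   Taking u = f_k, Phi f_k decreases and |h_k|^2 <= C (Phi f_k - Phi f_{k+1});
   hence |f_k - u|^2 + C Phi f_k decreases as soon as Phi u <= Phi f_k for all k.
   The bounded sequence f_k has a cluster point p, which is such a u, and a
   decreasing sequence of values clusters only at its limit, so f_k --> p.  When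
   sigma_k has a positive limit, the inequality passes to the limit and yields
   Phi p <= Phi u for every u. *)
Require Import Defs.
From HB Require Import structures.
From mathcomp Require Import all_boot all_order all_algebra.
From mathcomp Require Import all_classical all_reals all_analysis.
Import Order.TTheory GRing.Theory Num.Theory.
Import numFieldNormedType.Exports.
From mathcomp Require Import ring lra.

Set Implicit Arguments.
Unset Strict Implicit.
Unset Printing Implicit Defensive.

(* soft t x is the minimizer of y |-> (y - x)^2 / 2 + (t / 2) |y|; this is its
   variational inequality. *)
Lemma soft_prox (R : realType) (t x v : R) : 0 <= t ->
  (x - soft t x) * (v - soft t x) <= t / 2 * (`|v| - `|soft t x|).
Proof.
move=> t0; rewrite /soft; set h := t / 2.
have h0 : 0 <= h by rewrite divr_ge0.
have [vl vr] : - `|v| <= v /\ v <= `|v| by apply/andP; rewrite -ler_norml.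
case: ifPn => [xh|]; last rewrite -ltNge => xh.
  rewrite (_ : `|x + h| = - (x + h)); last by rewrite ler0_norm //; lra.
  nra.
case: ifPn => [|]; first rewrite ltr_norml normr0 => /andP[h1 h2].
  rewrite !subr0; nra.
rewrite -leNgt ler_normr => /orP[] xh'; last by lra.
rewrite (_ : `|x - h| = x - h); last by rewrite ger0_norm //; lra.
nra.
Qed.

(** * Euclidean inner product on row vectors *)

Section Dotv.
Context {R : realType} {d : nat}.
Implicit Types u v w : 'rV[R]_d.

Lemma dotvC u v : dotv u v = dotv v u.
Proof. by apply: eq_bigr => i _; rewrite mulrC. Qed.

Lemma dotvDl u v w : dotv (u + v) w = dotv u w + dotv v w.
Proof. by rewrite -big_split; apply: eq_bigr => i _; rewrite mxE mulrDl. Qed.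

Lemma dotvZl a u w : dotv (a *: u) w = a * dotv u w.
Proof. by rewrite /dotv mulr_sumr; apply: eq_bigr => i _; rewrite mxE mulrA. Qed.

Lemma dotv0l w : dotv 0 w = 0.
Proof. by rewrite -(scale0r 0) dotvZl mul0r. Qed.

Lemma dotvNl u w : dotv (- u) w = - dotv u w.
Proof. by rewrite -scaleN1r dotvZl mulN1r. Qed.

Lemma dotvBl u v w : dotv (u - v) w = dotv u w - dotv v w.
Proof. by rewrite dotvDl dotvNl. Qed.

Lemma dotvBr u v w : dotv w (u - v) = dotv w u - dotv w v.
Proof. by rewrite !(dotvC w) dotvBl. Qed.

Lemma dotv_suml (I : finType) (F : I -> 'rV[R]_d) w :
  dotv (\sum_i F i) w = \sum_i dotv (F i) w.
Proof.
apply: (big_morph (fun u => dotv u w)) => [u v|]; [exact: dotvDl|exact: dotv0l].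
Qed.

Lemma dotv_ge0 u : 0 <= dotv u u.
Proof. by apply: sumr_ge0 => i _; rewrite -expr2 sqr_ge0. Qed.

Lemma enorm_sqr u : enorm u ^+ 2 = dotv u u.
Proof. by rewrite sqr_sqrtr ?dotv_ge0. Qed.

Lemma enormZ a u : enorm (a *: u) = `|a| * enorm u.
Proof.
rewrite /enorm dotvZl dotvC dotvZl mulrA -expr2 sqrtrM ?sqr_ge0 //.
by rewrite sqrtr_sqr.
Qed.

Lemma sqr_coord_le_dotv u i : u 0 i ^+ 2 <= dotv u u.
Proof.
rewrite /dotv (bigD1 i) //= -expr2 lerDl.
by apply: sumr_ge0 => j _; rewrite -expr2 sqr_ge0.
Qed.

End Dotv.

(** * Expansion in the orthonormal basis and soft-thresholding as a proximal map *)

Section OrthonormalBasis.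
Context {R : realType} {d : nat} {Gam : finType} {phi : Gam -> 'rV[R]_d}.
Hypothesis hphi : orthonormal_basis phi.

Lemma orthonormal_expansion u : u = \sum_a dotv u (phi a) *: phi a.
Proof.
have [bphi ophi] := hphi.
(* Spanning gives some coefficients [c], reindexed from ordinals to [Gam]; pairing with [phi a] then
   identifies them. *)
have [c ->] : exists c : Gam -> R, u = \sum_a c a *: phi a.
  rewrite {1}(coord_basis (X := codom_tuple phi) bphi (memvf u)).
  exists (fun a => coord (codom_tuple phi) (enum_rank a) u).
  rewrite [RHS](reindex (fun i : 'I_#|Gam| => enum_val i)) /=; last first.
    exact/onW_bij/enum_val_bij.
  apply: eq_bigr => i _; rewrite enum_valK; congr (_ *: _).
  by rewrite (nth_map (enum_default i)) ?nth_enum_rank // -?cardE.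
apply: eq_bigr => a _; congr (_ *: _).
rewrite dotv_suml (bigD1 a) //= dotvZl ophi eqxx mulr1 big1 ?addr0 // => b.
by rewrite dotvZl ophi => /negbTE->; rewrite mulr0.
Qed.

Lemma parseval u v : dotv u v = \sum_a dotv u (phi a) * dotv v (phi a).
Proof.
rewrite {1}(orthonormal_expansion u) dotv_suml.
by apply: eq_bigr => a _; rewrite dotvZl (dotvC v).
Qed.

Lemma softv_coord t h a : dotv (softv phi t h) (phi a) = soft t (dotv h (phi a)).
Proof.
have [_ ophi] := hphi.
rewrite dotv_suml (bigD1 a) //= dotvZl ophi eqxx mulr1 big1 ?addr0 // => b.
by rewrite dotvZl ophi => /negbTE->; rewrite mulr0.
Qed.

(** Both sides split over the coordinates in [phi], the left one by Parseval, so [soft_prox] applies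
    term by term. *)
Lemma softv_prox t h u : 0 <= t ->
  dotv (h - softv phi t h) (u - softv phi t h)
    <= t / 2 * (norm1 phi u - norm1 phi (softv phi t h)).
Proof.
move=> t0; rewrite parseval /norm1 -sumrB mulr_sumr.
by apply: ler_sum => a _; rewrite !dotvBl softv_coord soft_prox.
Qed.

Lemma norm1_ge0 u : 0 <= norm1 phi u.
Proof. exact: sumr_ge0. Qed.

(** Turns a bound on [Phi] into a bound in the sup norm, hence into relative compactness of the
    iterates. *)
Lemma normr_le_norm1 u : `|u| <= norm1 phi u * \sum_a `|phi a|.
Proof.
rewrite {1}(orthonormal_expansion u) /norm1 mulr_suml.
apply: (le_trans (ler_norm_sum _ _ _)); apply: ler_sum => a _.
rewrite normrZ ler_wpM2l // (bigD1 a) //= lerDl; exact: sumr_ge0.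
Qed.

End OrthonormalBasis.

(** * Cauchy-Schwarz in the Hilbert space and the one-step inequality *)

Section HilbertSpace.
Context {R : realType} {G : completeNormedModType R} {ip : {dot G for idfun}}.
Hypothesis hip : induces_norm ip.

Lemma ip_sqr_norm x : ip x x = `|x| ^+ 2.
Proof.
rewrite hip sqr_sqrtr //.
have [->|/(neq0_dnorm_gt0 (s := ip))/ltW//] := eqVneq x 0.
by rewrite linear0l.
Qed.

Lemma ipC x y : ip x y = ip y x.
Proof. by rewrite (hermC ip x y) /= expr0 mul1r. Qed.

(** Cauchy-Schwarz: the squared norm of [|y| x - |x| y] equals [2 |x| |y| (|x| |y| - ip x y)]. *)
Lemma ip_le_norm x y : ip x y <= `|x| * `|y|.
Proof.
have [->|x0] := eqVneq x 0; first by rewrite linear0l normr0 mul0r.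
have [->|y0] := eqVneq y 0; first by rewrite linear0r normr0 mulr0.
have xy0 : 0 < `|x| * `|y| by rewrite mulr_gt0 ?normr_gt0.
have : 0 <= ip (`|y| *: x - `|x| *: y) (`|y| *: x - `|x| *: y).
  by rewrite ip_sqr_norm sqr_ge0.
rewrite linearBl !linearBr !linearZl_LR !linearZr_LR /= (ipC y x) !ip_sqr_norm.
have scaleE (a b : R) : a *: (b : R^o) = a * b by [].
rewrite !scaleE -(ler_pM2l xy0); lra.
Qed.

(** Right side minus left side is [2 (|r| |t| - ip r t) + (|r| - |s|)^2]. In use, [r], [s], [t] are
    the residuals at the current, next and comparison points. *)
Lemma residual_ineq r s t :
  2 * ip r (t - s) <= 2 * `|r| * (`|t| - `|s|) + `|s - r| ^+ 2.
Proof.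
have := ip_le_norm r t; have := sqr_ge0 (`|r| - `|s|).
rewrite -(ip_sqr_norm (s - r)) !linearBl !linearBr /= (ipC s r) !ip_sqr_norm.
nra.
Qed.

Context {d : nat} {Gam : finType} {phi : Gam -> 'rV[R]_d}.
Hypothesis hphi : orthonormal_basis phi.
Variables (A : {linear 'rV[R]_d -> G}) (g : G) (mu tau : R).
Hypotheses (mu_gt0 : 0 < mu) (tau_gt0 : 0 < tau).

(** Twice [softv_prox] plus [tau] times [residual_ineq]: the adjoint turns the gradient term into an
    inner product of residuals, and the terms in [v], [v'], [u] combine by polarization. Nothing is
    divided by [|A v - g|], so a zero residual is covered. *)
Lemma proximal_step (v v' u : 'rV[R]_d) :
  v' = softv phi (2 * tau * mu * `|A v - g|) (v + tau *: adjoint ip A (g - A v)) ->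
  dotv (v' - u) (v' - u)
      + 2 * tau * `|A v - g| * (Phi phi A g mu v' - Phi phi A g mu u)
    <= dotv (v - u) (v - u) + (tau * `|A (v' - v)| ^+ 2 - dotv (v' - v) (v' - v)).
Proof.
move=> v'E; set s := `|A v - g|.
have : 0 <= 2 * tau * mu * s.
  by rewrite !mulr_ge0 ?(ltW tau_gt0) ?(ltW mu_gt0) ?normr_ge0.
move=> /(softv_prox hphi (v + tau *: adjoint ip A (g - A v)) u) prox.
move: prox; rewrite -v'E (_ : 2 * tau * mu * s / 2 = tau * mu * s); last by lra.
rewrite [v + _ - v']addrAC (dotvDl (v - v')) dotvZl.
rewrite (dotvC (adjoint _ _ _)) -adjointP.
have -> : A (u - v') = (A u - g) - (A v' - g).
  by rewrite linearB opprB addrA subrK.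
have -> : g - A v = - (A v - g) by rewrite opprB.
have := residual_ineq (A v - g) (A v' - g) (A u - g).
rewrite ipC linearNr /= (_ : A v' - g - (A v - g) = A (v' - v)); last first.
  by rewrite (linearB A) opprB addrA subrK.
rewrite -/s /Phi !(dotvBl, dotvBr) (dotvC u v) (dotvC u v') (dotvC v' v).
move=> /(ler_wpM2l (ltW tau_gt0)); lra.
Qed.

Lemma opnorm_le w : bounded_operator A -> `|A w| <= opnorm A * enorm w.
Proof.
move=> [M AM]; have [w0|w0] := eqVneq (enorm w) 0.
  by rewrite (le_trans (AM w)) // w0 !mulr0.
have wp : 0 < enorm w by rewrite lt_neqAle eq_sym w0 sqrtr_ge0.
rewrite -ler_pdivrMr //; apply: sup_ubound.
  exists `|M| => _ [v /= v1 <-]; apply: (le_trans (AM v)).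
  rewrite (le_trans (ler_norm _)) // normrM ler_piMr //.
  by rewrite ger0_norm ?sqrtr_ge0.
exists ((enorm w)^-1 *: w).
  by rewrite /= enormZ ger0_norm ?invr_ge0 ?sqrtr_ge0 // mulVf.
by rewrite linearZ normrZ ger0_norm ?invr_ge0 ?sqrtr_ge0 // mulrC.
Qed.

End HilbertSpace.

(** * Cluster points, continuity and compactness *)

Section Convergence.
Context {R : realType}.

Lemma nonincreasing_cluster_cvg (T : topologicalType) (x : nat -> T) (p : T)
    (F : T -> R) :
  {for p, continuous F} -> nonincreasing_seq (F \o x) ->
  cluster (x @ \oo) p -> (F \o x) @ \oo --> F p.
Proof.
move=> cF Fx px.
have frequently (P : set T) N : nbhs p P -> exists2 k, (N <= k)%N & P (x k).
  move=> pP.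
  have [|_ [[k Nk <-] Pxk]] := px (x @` [set k | (N <= k)%N]) P _ pP.
    by exists N => // k /= Nk; exists k.
  by exists k.
(* Otherwise a later visit near [p] would have a value above [F (x k)], against monotonicity. *)
have Fpx k : F p <= F (x k).
  rewrite leNgt; apply/negP => Fxk.
  have [m km] := frequently _ k (cvgr_gt _ cF _ Fxk).
  by rewrite /= ltNge Fx.
apply/cvgrPdist_le => e e0.
have Fpe : F p < F p + e by rewrite ltrDl.
have [K _ FK] := frequently _ 0%N (cvgr_lt _ cF _ Fpe).
exists K => // k /= Kk; rewrite distrC ger0_norm ?subr_ge0 // lerBlDl.
exact: le_trans (Fx _ _ Kk) (ltW FK).
Qed.

Lemma continuous_sum (T : topologicalType) (V : normedModType R) (I : finType)
    (F : I -> T -> V) :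
  (forall i, continuous (F i)) -> continuous (fun x => \sum_i F i x).
Proof. by move=> cF; apply: continuous_big => // x; exact: add_continuous. Qed.

Lemma linear_rV_continuous (d : nat) (V : normedModType R)
  (A : {linear 'rV[R]_d -> V}) : continuous A.
Proof.
rewrite (_ : A = (fun u => \sum_i u 0 i *: A (delta_mx 0 i)) :> (_ -> _)).
  apply: continuous_sum => i u; apply: (cvgZ (F := nbhs u)); last exact: cvg_cst.
  exact: coord_continuous.
apply/funext => u; rewrite {1}(row_sum_delta u) linear_sum.
by apply: eq_bigr => i _; rewrite linearZ.
Qed.

Lemma dotv_continuous (d : nat) (w : 'rV[R]_d) : continuous (fun u => dotv u w).
Proof.
apply: continuous_sum => i u; apply: (cvgMl (F := nbhs u)).
exact: coord_continuous.
Qed.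

Lemma dotv_sub_continuous (d : nat) (w : 'rV[R]_d) :
  continuous (fun u : 'rV[R]_d => dotv (u - w) (u - w)).
Proof.
apply: continuous_sum => i u.
have cu : v 0 i - w 0 i @[v --> u] --> u 0 i - w 0 i.
  by apply: cvgB; [exact: coord_continuous|exact: cvg_cst].
have -> : (fun v : 'rV[R]_d => (v - w) 0 i * (v - w) 0 i) =
    (fun v => (v 0 i - w 0 i) * (v 0 i - w 0 i)).
  by apply/funext => v; rewrite !mxE.
exact: (cvgM cu cu).
Qed.

Lemma Phi_continuous (d : nat) (Gam : finType) (phi : Gam -> 'rV[R]_d)
    (G : completeNormedModType R) (A : {linear 'rV[R]_d -> G}) g mu :
  continuous (Phi phi A g mu).
Proof.
move=> u; apply: (cvgD (F := nbhs u)).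
  apply: cvg_norm; apply: cvgB; last exact: cvg_cst.
  exact: linear_rV_continuous.
apply: cvgMr; apply: continuous_sum => a v.
by apply: (cvg_norm (F := nbhs v)); exact: dotv_continuous.
Qed.

Lemma bounded_seq_cluster (d : nat) (x : nat -> 'rV[R]_d) (M : R) :
  (forall k, `|x k| <= M) -> exists p, cluster (x @ \oo) p.
Proof.
move=> xM.
have cptB : compact (closed_ball_ Num.norm (0 : 'rV[R]_d) M).
  apply: bounded_closed_compact; last exact: closed_closed_ball_.
  exists M; split; first exact: num_real.
  move=> N MN v; rewrite /closed_ball_ /= sub0r normrN => /le_trans; apply.
  exact: ltW.
have [|p [_ px]] := cptB (x @ \oo) _; last by exists p.
by exists 0%N => // k _; rewrite /closed_ball_ /= sub0r normrN.
Qed.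

Lemma dotv_eq0 (d : nat) (u : 'rV[R]_d) : dotv u u = 0 -> u = 0.
Proof.
move=> u0; apply/rowP => i; apply/eqP; rewrite mxE -sqrf_eq0.
by rewrite eq_le sqr_ge0 -u0 sqr_coord_le_dotv.
Qed.

(** Each squared coordinate is at most the squared Euclidean norm, so Euclidean convergence implies
    sup-norm convergence. *)
Lemma rV_cvg_dotv (d : nat) (x : nat -> 'rV[R]_d) (p : 'rV[R]_d) :
  dotv (x k - p) (x k - p) @[k --> \oo] --> (0 : R) -> x @ \oo --> p.
Proof.
move=> x0; apply/cvg_ballP => e e0.
near=> k; split=> // i j; rewrite /ball /= ord1 distrC.
rewrite -(ltr_pXn2r (n := 2)) ?nnegrE ?(ltW e0) // real_normK ?num_real //.
have := sqr_coord_le_dotv (x k - p) j; rewrite !mxE => /le_lt_trans; apply.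
by near: k; apply: (cvgr_lt _ x0); rewrite exprn_gt0.
Unshelve. all: by end_near.
Qed.

End Convergence.

(** * Descent, monotone distance to the cluster point and passage to the limit *)

Theorem theorem1 (R : realType) (d : nat)
    (Gam : finType) (phi : Gam -> 'rV[R]_d) (hphi : orthonormal_basis phi)
    (G : completeNormedModType R) (ip : {dot G for idfun})
    (hip : induces_norm ip)
    (A : {linear 'rV[R]_d -> G}) (hA : bounded_operator A)
    (g : G) (mu : R) (hmu : 0 < mu)
    (tau : R) (htau0 : 0 < tau)
    (htau : opnorm A != 0 -> tau < 2 / opnorm A ^+ 2)
    (f0 : 'rV[R]_d) (hf0 : 0 < `|A f0 - g|)
    (f : nat -> 'rV[R]_d) (sigma : nat -> R)
    (hf_0 : f 0%N = f0) (hsigma_0 : sigma 0%N = `|A f0 - g|)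
    (hf_S : forall k : nat,
      f k.+1 = softv phi (2 * tau * mu * sigma k)
                 (f k + tau *: adjoint ip A (g - A (f k))))
    (hsigma_S : forall k : nat, sigma k.+1 = `|A (f k.+1) - g|) :
  exists (flim : 'rV[R]_d) (sigmalim : R),
    (f k, sigma k) @[k --> \oo] --> (flim, sigmalim) /\
    (0 < sigmalim -> minimizer (Phi phi A g mu) flim).
Proof.
have sE k : sigma k = `|A (f k) - g|.
  by case: k => [|k]; rewrite ?hsigma_S // hf_0.
have s_ge0 k : 0 <= sigma k by rewrite sE.
set B := opnorm A; set F := Phi phi A g mu.
pose D (u : 'rV[R]_d) k := dotv (f k - u) (f k - u).
pose H k := dotv (f k.+1 - f k) (f k.+1 - f k).
(* The margin in the step-size condition: bounding [|A h|] by [B |h|] leaves the factor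
   [tau B^2 - 1 = 1 - c] on [H k]. *)
set c : R := 2 - tau * B ^+ 2.
have c_gt0 : 0 < c.
  have [B0|B0] := eqVneq B 0; first by rewrite /c B0 expr0n mulr0 subr0.
  by rewrite subr_gt0 -ltr_pdivlMr ?htau // exprn_even_gt0.
have step (u : 'rV[R]_d) k :
    D u k.+1 + 2 * tau * sigma k * (F (f k.+1) - F u) <= D u k + (1 - c) * H k.
  have := proximal_step hip hphi hmu htau0 u (v := f k) (v' := f k.+1)
    (A := A) (g := g).
  rewrite -sE => /(_ (hf_S k)) /le_trans; apply.
  rewrite lerD2l -/(H k) (_ : 1 - c = tau * B ^+ 2 - 1); last by rewrite /c; ring.
  rewrite mulrBl mul1r lerD2r -mulrA ler_pM2l // /H -enorm_sqr -exprMn.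
  have Ah := opnorm_le (f k.+1 - f k) hA.
  by rewrite lerXn2r ?nnegrE ?(le_trans _ Ah).
have H_ge0 k : 0 <= H k := dotv_ge0 _.
have descent k : c * H k <= 2 * tau * sigma k * (F (f k) - F (f k.+1)).
  have := step (f k) k; rewrite {2}/D subrr dotv0l add0r.
  by rewrite /D -/(H k); lra.
have F_dec : nonincreasing_seq (F \o f).
  (* If [sigma k = 0], [descent] forces [H k = 0] and the iterate stays put; otherwise it can be
     divided by [sigma k]. *)
  apply/nonincreasing_seqP => k /=; have [s0|s0] := eqVneq (sigma k) 0.
    have H0 : H k = 0.
      apply/eqP; rewrite eq_le H_ge0 andbT -(ler_pM2l c_gt0).
      by rewrite (le_trans (descent k)) // s0 !mulr0 mul0r.
    by move/dotv_eq0/eqP: H0; rewrite subr_eq0 => /eqP->.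
  have s_gt0 : 0 < sigma k by rewrite lt_neqAle eq_sym s0 s_ge0.
  rewrite -subr_ge0 -(pmulr_rge0 _ (_ : 0 < 2 * tau * sigma k)) ?mulr_gt0 //.
  by apply: le_trans (descent k); rewrite mulr_ge0 // (ltW c_gt0).
have F0 k : F (f k) <= F (f 0%N) by exact: F_dec.
have s_le k : sigma k <= F (f 0%N).
  by rewrite (le_trans _ (F0 k)) // sE lerDl mulr_ge0 ?norm1_ge0 // (ltW hmu).
(* Comes from [descent] with [sigma k] replaced by its uniform bound [F (f 0)]. *)
set C := 2 * tau * F (f 0%N) / c.
have H_le k : H k <= C * (F (f k) - F (f k.+1)).
  rewrite -(ler_pM2l c_gt0) (le_trans (descent k)) // /C.
  rewrite mulrA (mulrC c) divfK ?gt_eqF //.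
  by rewrite ler_wpM2r ?subr_ge0 ?F_dec // ler_pM2l ?mulr_gt0.
(* Since [1 - c <= 1], the error in [step] is at most [H k], which [H_le] bounds by a telescoping
   difference. *)
have key (u : 'rV[R]_d) k : D u k.+1 + 2 * tau * sigma k * (F (f k.+1) - F u)
    <= D u k + C * (F (f k) - F (f k.+1)).
  rewrite (le_trans (step u k)) // lerD2l (le_trans _ (H_le k)) //.
  by rewrite ler_piMl // lerBlDr lerDl ltW.
have [p cl_p] : exists p, cluster (f @ \oo) p.
  apply: (bounded_seq_cluster (M := F (f 0%N) / mu * \sum_a `|phi a|)) => k.
  rewrite (le_trans (normr_le_norm1 hphi _)) // ler_wpM2r ?sumr_ge0 //.
  rewrite ler_pdivlMr // mulrC (le_trans _ (F0 k)) //.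
  by rewrite /F /Phi lerDr.
have cF : continuous F by exact: Phi_continuous.
have Fp := nonincreasing_cluster_cvg (cF p) F_dec cl_p.
have Fp_le k : F p <= F (f k).
  rewrite -(cvg_lim _ Fp) //; apply: nonincreasing_cvgn_ge => //.
  exact: cvgP Fp.
have FS : F (f k.+1) @[k --> \oo] --> F p.
  by move: Fp; rewrite -(cvg_shiftS (F \o f)).
have dF0 : F (f k) - F (f k.+1) @[k --> \oo] --> 0.
  by rewrite -(subrr (F p)); exact: cvgB Fp FS.
(* A Lyapunov function: [key] at [u = p] and [Fp_le] make it decrease along [f]. Subtracting the
   limit of [C * F (f k)] from that of [E (f k)] then leaves squared distance 0 to [p]. *)
pose E (v : 'rV[R]_d) := dotv (v - p) (v - p) + C * F v.
have cE : continuous E.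
  move=> v; apply: (cvgD (F := nbhs v)); first exact: dotv_sub_continuous.
  by apply: (cvgMr (F := nbhs v)); exact: cF.
have E_dec : nonincreasing_seq (E \o f).
  apply/nonincreasing_seqP => k; rewrite /= /E.
  have := key p k; have : 0 <= 2 * tau * sigma k * (F (f k.+1) - F p).
    by rewrite !mulr_ge0 ?subr_ge0 // (ltW htau0).
  by rewrite /D; lra.
have Ep := nonincreasing_cluster_cvg (cE p) E_dec cl_p.
have f_p : f @ \oo --> p.
  apply: rV_cvg_dotv.
  have -> : (fun k => dotv (f k - p) (f k - p)) =
      (fun k => E (f k) - C * F (f k)).
    by apply/funext => k; rewrite /E addrK.
  have -> : 0 = E p - C * F p by rewrite /E addrK subrr dotv0l.
  by apply: cvgB Ep _; exact: cvgMr.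
exists p, `|A p - g|.
have s_cvg : sigma @ \oo --> `|A p - g|.
  rewrite (_ : sigma = fun k => `|A (f k) - g|); last exact/funext.
  apply: cvg_norm; apply: cvgB; last exact: cvg_cst.
  apply: (cvg_comp _ A f_p); exact: linear_rV_continuous.
split; first exact: (cvg_pair f_p s_cvg).
move=> sp u.
have D_cvg : D u @ \oo --> dotv (p - u) (p - u).
  apply: (cvg_comp _ (fun v => dotv (v - u) (v - u)) f_p).
  exact: dotv_sub_continuous.
(* The positive limit of [sigma] allows multiplying the goal by it; the result is the limit of
   [key], where the differences of [D u] and of [F] along [f] vanish. *)
rewrite -subr_le0 -(pmulr_rle0 _ (_ : 0 < 2 * tau * `|A p - g|)) ?mulr_gt0 //.
have lhs : 2 * tau * sigma k * (F (f k.+1) - F u) @[k --> \oo] -->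
    2 * tau * `|A p - g| * (F p - F u).
  apply: cvgM; first exact: cvgMr.
  by apply: cvgB => //; exact: cvg_cst.
have rhs : D u k - D u k.+1 + C * (F (f k) - F (f k.+1)) @[k --> \oo] --> 0.
  have -> : 0 = dotv (p - u) (p - u) - dotv (p - u) (p - u) + C * 0 :> R.
    by rewrite subrr mulr0 addr0.
  apply: cvgD; last exact: cvgMr.
  by apply: cvgB => //; move: D_cvg; rewrite -(cvg_shiftS (D u)).
apply: (ler_cvg_to lhs rhs); near=> k.
by have := key u k; lra.
Unshelve. all: by end_near.
Qed.
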